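(* Let $\langle u_n\rangle_{n=1}^{\infty}$ be an arbitrary sequence of real numbers, and for $n\in\mathbb{N}$ define $$v_n:=\min\Big\{u_{n_1}+\cdots+u_{n_k}\ \Big|\ k\in\mathbb{N},\ n_1,\dots,n_k\in\mathbb{N},\ n_1+\cdots+n_k=n\Big\}.$$ Then $\langle v_n\rangle_{n=1}^{\infty}$ is the largest subadditive sequence bounded above by $\langle u_n\rangle_{n=1}^{\infty}$; that is, $\langle v_n\rangle_{n=1}^{\infty}$ is subadditive, $v_n\le u_n$ for all $n\in\mathbb{N}$, and every subadditive sequence $\langle w_n\rangle_{n=1}^{\infty}$ with $w_n\le u_n$ for all $n\in\mathbb{N}$ satisfies $w_n\le v_n$ for all $n\in\mathbb{N}$.
   Context: $\mathbb{N}=\{1,2,3,\dots\}$. A real sequence $\langle u_n\rangle_{n=1}^{\infty}$ is subadditive if $u_{m+n}\le u_m+u_n$ for all $m,n\in\mathbb{N}$. *)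

(* Defs.v *)
From mathcomp Require Import all_boot all_order all_algebra.
From mathcomp Require Import classical_sets reals.
Set Implicit Arguments.
Unset Strict Implicit.
Unset Printing Implicit Defensive.
Import Order.TTheory GRing.Theory Num.Theory.
Local Open Scope classical_set_scope.
Local Open Scope ring_scope.

(* A sequence (u_n)_{n >= 1} is a function [nat -> R]; its value at 0 is never
   used, so every statement about indices is guarded by [0 < n]. *)

Definition subadditive (R : realType) (u : nat -> R) : Prop :=
  forall m n : nat, (0 < m)%N -> (0 < n)%N -> u (m + n)%N <= u m + u n.

(* The sums u_{n_1} + ... + u_{n_k} with k >= 1, every n_i >= 1 and
   n_1 + ... + n_k = n; [s] is the list [:: n_1; ...; n_k]. *)
Definition composition_sums (R : realType) (u : nat -> R) (n : nat) : set R :=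
  [set x | exists s : seq nat,
     [/\ (0 < size s)%N, all (fun i => (0 < i)%N) s, sumn s = n
       & x = \sum_(i <- s) u i]].

Definition is_min (R : realType) (A : set R) (x : R) : Prop :=
  A x /\ lbound A x.

(* Main.v *)
Require Import Defs.
From mathcomp Require Import all_boot all_order all_algebra.
From mathcomp Require Import classical_sets reals.
Set Implicit Arguments.
Unset Strict Implicit.
Unset Printing Implicit Defensive.
Import Order.TTheory GRing.Theory Num.Theory.
Local Open Scope classical_set_scope.
Local Open Scope ring_scope.

(** A positive [n] has finitely many compositions, and at least one, so the minimum exists
    ([composition_sums_min]). Concatenating compositions of [m] and [n] gives one of [m + n]
    ([composition_sumsD]), whence [v] is subadditive; the one-part composition gives [v n <= u n].
    If [w] is subadditive and below [u], iterating subadditivity ([subadditive_sumn]) along a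
    composition of [n] that attains [v n] bounds [w n] by the sum of [w] over its parts, hence by
    [v n]. *)

Lemma size_le_sumn (s : seq nat) :
  all (fun i => (0 < i)%N) s -> (size s <= sumn s)%N.
Proof.
elim: s => //= i s IHs /andP[i_gt0 /IHs le_s].
by rewrite -add1n leq_add.
Qed.

Lemma le_sumn (s : seq nat) (i : nat) : i \in s -> (i <= sumn s)%N.
Proof.
elim: s => //= j s IHs; rewrite inE => /orP[/eqP-> | /IHs le_is].
  exact: leq_addr.
exact: leq_trans le_is (leq_addl _ _).
Qed.

Lemma sumn_gt0 (s : seq nat) :
  (0 < size s)%N -> all (fun i => (0 < i)%N) s -> (0 < sumn s)%N.
Proof. by move=> s_gt0 /size_le_sumn; apply: leq_trans. Qed.

Lemma composition_sums_single (R : realType) (u : nat -> R) (n : nat) :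
  (0 < n)%N -> composition_sums u n (u n).
Proof.
by move=> n_gt0; exists [:: n]; split; rewrite ?big_seq1 //= ?n_gt0 // addn0.
Qed.

Lemma composition_sumsD (R : realType) (u : nat -> R) (m n : nat) (x y : R) :
  composition_sums u m x -> composition_sums u n y ->
  composition_sums u (m + n)%N (x + y).
Proof.
move=> [s [s_gt0 s_pos <- ->]] [t [t_gt0 t_pos <- ->]]; exists (s ++ t); split.
- by rewrite size_cat ltn_addr.
- by rewrite all_cat s_pos.
- by rewrite sumn_cat.
- by rewrite big_cat.
Qed.

(* A composition of [n] has at most [n] parts, each at most [n], so it is
   encoded by an element of the finite type [n.-bseq 'I_n.+1]. *)
Lemma composition_sums_min (R : realType) (u : nat -> R) (n : nat) :
  (0 < n)%N -> exists x : R, is_min (composition_sums u n) x.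
Proof.
move=> n_gt0.
pose parts (t : n.-bseq 'I_n.+1) := [seq val i | i <- t].
pose P t := [&& (0 < size (parts t))%N, all (fun i => (0 < i)%N) (parts t)
              & sumn (parts t) == n].
have encode (s : seq nat) : (0 < size s)%N -> all (fun i => (0 < i)%N) s ->
    sumn s = n -> exists2 t, P t & parts t = s.
  move=> s_gt0 s_pos sum_s.
  have size_t : (size [seq (inord i : 'I_n.+1) | i <- s] <= n)%N.
    by rewrite size_map -sum_s size_le_sumn.
  (* [inord] sends numbers out of range to 0, but each part is at most the total [n], so nothing is
     lost. *)
  have parts_t : parts (Bseq size_t) = s.
    rewrite /parts /= -map_comp map_id_in // => i /le_sumn; rewrite sum_s => le_in.
    by rewrite /= inordK.
  by exists (Bseq size_t); rewrite // /P parts_t s_gt0 s_pos sum_s eqxx.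
(* [arg_minP] needs one element satisfying [P]: the one-part composition. *)
have [|||t0 Pt0 _] := encode [:: n]; rewrite /= ?n_gt0 ?addn0 //.
case: (arg_minP (fun t => \sum_(i <- parts t) u i) Pt0) => t Pt t_min.
exists (\sum_(i <- parts t) u i); split.
  by case/and3P: Pt => t_gt0 t_pos /eqP sum_t; exists (parts t).
move=> _ [s [s_gt0 s_pos sum_s ->]].
by have [t' Pt' <-] := encode s s_gt0 s_pos sum_s; apply: t_min.
Qed.

(** Induction starts at singletons, since [w 0] is unconstrained; splitting off the head is then
    legitimate because the nonempty tail has a positive sum. *)
Lemma subadditive_sumn (R : realType) (w : nat -> R) (s : seq nat) :
  subadditive w -> (0 < size s)%N -> all (fun i => (0 < i)%N) s ->
  w (sumn s) <= \sum_(i <- s) w i.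
Proof.
move=> w_sub; elim: s => // i [|j s] IHs _ /=; first by rewrite big_seq1 addn0.
case/andP=> i_gt0 s_pos; rewrite big_cons.
apply: le_trans (w_sub _ _ i_gt0 (sumn_gt0 (s := j :: s) isT s_pos)) _.
by rewrite lerD2l IHs.
Qed.

Theorem proposition1p3 (R : realType) (u : nat -> R) :
  (forall n : nat, (0 < n)%N -> exists x : R, is_min (composition_sums u n) x)
  /\
  (forall v : nat -> R,
     (forall n : nat, (0 < n)%N -> is_min (composition_sums u n) (v n)) ->
     [/\ subadditive v,
         forall n : nat, (0 < n)%N -> v n <= u n
       & forall w : nat -> R,
           subadditive w ->
           (forall n : nat, (0 < n)%N -> w n <= u n) ->
           forall n : nat, (0 < n)%N -> w n <= v n]).
Proof.
split=> [|v v_min]; first exact: composition_sums_min.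
split=> [m n m_gt0 n_gt0 | n n_gt0 | w w_sub le_wu n n_gt0].
(* By minimality of [v (m + n)], it is enough that [v m + v n] is a composition sum of [m + n]. *)
- have [_] := v_min _ (ltn_addr n m_gt0); apply.
  by apply: composition_sumsD; [case: (v_min m m_gt0) | case: (v_min n n_gt0)].
- by have [_] := v_min n n_gt0; apply; apply: composition_sums_single.
have [[s [s_gt0 s_pos <- ->]] _] := v_min n n_gt0.
apply: le_trans (subadditive_sumn w_sub s_gt0 s_pos) _.
(* [big_seq] keeps the membership of [i] in [s], which yields the positivity that [le_wu]
   requires. *)
by rewrite !big_seq ler_sum // => i /(allP s_pos); apply: le_wu.
Qed.
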